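(* Let $n\neq-2,-1$ be real and $\mu=\frac{3n+4}{n+2}$. The point transformation $$x'=v,\qquad t'=t,\qquad u'=x^{-\frac{2}{n+2}}u^{-1},\qquad v'=\frac{n+2}{2(n+1)}x^{\frac{2(n+1)}{n+2}}$$ maps the system $$v'_{x'}=u',\qquad v'_{t'}={u'}^{-(n+2)}u'_{x'}$$ into the system $$v_x=ux,\qquad v_t=xu^nu_x+\frac{\mu-1}{n+1}u^{n+1}.$$ Moreover, the point transformation $x'=v$, $t'=t$, $v'=\frac{n+2}{2n+2}x^{\frac{2n+2}{n+2}}$ maps the equation $$v'_{t'}={v'_{x'}}^{-(n+2)}v'_{x'x'}$$ into the equation $$v_t=\left(\frac{v_x}{x}\right)^nv_{xx}-\frac{n}{n+2}\left(\frac{v_x}{x}\right)^{n+1}.$$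
   Context: Subscripts denote partial derivatives. A point transformation $x'=P(x,t,v)$, $t'=t$, $u'=R(x,t,u,v)$, $v'=S(x,t,v)$ ''maps a system $E'$ for $(u',v')(x',t')$ into a system $E$ for $(u,v)(x,t)$'' if: whenever $(u,v)$ are smooth functions on an open set $D\subset\{x>0\}$ with $u>0$, such that $(x,t)\mapsto(P(x,t,v(x,t)),t)$ is a diffeomorphism of $D$ onto an open set $D'$, and $(u',v')$ are the functions on $D'$ whose values at $(P(x,t,v(x,t)),t)$ are $R(x,t,u(x,t),v(x,t))$ and $S(x,t,v(x,t))$, then $(u',v')$ satisfies $E'$ on $D'$ if and only if $(u,v)$ satisfies $E$ on $D$. For the scalar equations the same definition is used without $u,u'$, for $v$ with $v_x>0$ on $D\subset\{x>0\}$. *)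

(* Defs.v *)
From Stdlib Require Import Reals Lra.
From Coquelicot Require Import Coquelicot.
Open Scope R_scope.

(* Functions of (x, t) are total functions R -> R -> R; only their values on
   the open set under consideration matter, since all derivatives below are
   taken at points of that set. *)

Definition dx (f : R -> R -> R) (x t : R) : R := Derive (fun z => f z t) x.
Definition dt (f : R -> R -> R) (x t : R) : R := Derive (fun z => f x z) t.
Definition dxx (f : R -> R -> R) (x t : R) : R := Derive_n (fun z => f z t) 2 x.

(* C^infinity on D, for D open. *)
Definition smooth_on (D : R * R -> Prop) (f : R -> R -> R) : Prop :=
  forall (k : nat) (x t : R), D (x, t) -> ex_diff_n f k x t.

(* (x, t) |-> (F1 x t, F2 x t) is a diffeomorphism of the open set D onto the
   open set D'. *)
Definition is_diffeo (D D' : R * R -> Prop) (F1 F2 : R -> R -> R) : Prop :=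
  open D /\ open D' /\
  smooth_on D F1 /\ smooth_on D F2 /\
  (forall x t, D (x, t) -> D' (F1 x t, F2 x t)) /\
  exists G1 G2 : R -> R -> R,
    smooth_on D' G1 /\ smooth_on D' G2 /\
    (forall y s, D' (y, s) -> D (G1 y s, G2 y s)) /\
    (forall x t, D (x, t) ->
       G1 (F1 x t) (F2 x t) = x /\ G2 (F1 x t) (F2 x t) = t) /\
    (forall y s, D' (y, s) ->
       F1 (G1 y s) (G2 y s) = y /\ F2 (G1 y s) (G2 y s) = s).

(* The system, resp. scalar equation, is given by the relation it imposes on
   the unknown functions at a point. *)
Definition system := (R -> R -> R) -> (R -> R -> R) -> R -> R -> Prop.
Definition equation := (R -> R -> R) -> R -> R -> Prop.

(* x' = P(x,t,v), t' = t, u' = Q(x,t,u,v), v' = S(x,t,v) maps the system E'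
   for (u',v')(x',t') into the system E for (u,v)(x,t). *)
Definition maps_system (P : R -> R -> R -> R) (Q : R -> R -> R -> R -> R)
    (S : R -> R -> R -> R) (E' E : system) : Prop :=
  forall (D D' : R * R -> Prop) (u v u' v' : R -> R -> R),
    open D ->
    (forall x t, D (x, t) -> 0 < x) ->
    smooth_on D u -> smooth_on D v ->
    (forall x t, D (x, t) -> 0 < u x t) ->
    is_diffeo D D' (fun x t => P x t (v x t)) (fun _ t => t) ->
    (forall x t, D (x, t) -> u' (P x t (v x t)) t = Q x t (u x t) (v x t)) ->
    (forall x t, D (x, t) -> v' (P x t (v x t)) t = S x t (v x t)) ->
    (forall x' t', D' (x', t') -> E' u' v' x' t') <->
    (forall x t, D (x, t) -> E u v x t).

Definition maps_equation (P S : R -> R -> R -> R) (E' E : equation) : Prop :=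
  forall (D D' : R * R -> Prop) (v v' : R -> R -> R),
    open D ->
    (forall x t, D (x, t) -> 0 < x) ->
    smooth_on D v ->
    (forall x t, D (x, t) -> 0 < dx v x t) ->
    is_diffeo D D' (fun x t => P x t (v x t)) (fun _ t => t) ->
    (forall x t, D (x, t) -> v' (P x t (v x t)) t = S x t (v x t)) ->
    (forall x' t', D' (x', t') -> E' v' x' t') <->
    (forall x t, D (x, t) -> E v x t).

(* Main.v *)
Require Import Defs.
From Stdlib Require Import Reals Lra.
From Coquelicot Require Import Coquelicot.
Open Scope R_scope.

(** Since [x' = v] and [t' = t], the map is a hodograph transformation: [v]
    becomes an independent variable and its inverse function [X], with
    [X (v x t) t = x], the unknown. The implicit function rules
    [X_y = 1 / v_x] and [X_s = - v_t / v_x] ([hodograph_inverse]) express the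
    derivatives of [u'] and [v'] at [(v x t, t)] by those of [u] and [v] at
    [(x, t)] ([hodograph_dx], [hodograph_dt]). As the map is onto, it suffices
    to compare the two systems at corresponding points
    ([hodograph_forall_iff]), and there they are equivalent by algebra.

    With [c = 2 / (n + 2)], the new unknowns are [u' = x ^ (- c) / u] and
    [v' = S x] with [S' x = x ^ (1 - c)]. So [v'_x' = u'] reads
    [x ^ (1 - c) / v_x = x ^ (- c) / u], that is [v_x = u x] ([new_vx_iff]).
    Also [u' ^ (- (n + 2)) = x ^ 2 u ^ (n + 2)], so that the second equation
    reads
    [- x ^ (1 - c) v_t / v_x =
     - x ^ (1 - c) (x u ^ n u_x + c u ^ (n + 1)) / v_x]
    ([new_evolution_iff]), and [c] is [(mu - 1) / (n + 1)].

    The scalar equations are those second equations for [u = v_x / x] and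
    [u' = v'_x'], which are related as in the system by [new_vx_iff]. *)

(** * Smooth functions on open sets *)

Lemma open_locally_x (D : R * R -> Prop) (x t : R) :
  open D -> D (x, t) -> locally x (fun z => D (z, t)).
Proof.
intros oD Dxt.
apply (locally_2d_1d_const_y (fun a b => D (a, b)) x t).
apply locally_2d_locally.
apply (filter_imp D); [intros [a b]; exact (fun h => h) | exact (oD _ Dxt)].
Qed.

Lemma open_locally_t (D : R * R -> Prop) (x t : R) :
  open D -> D (x, t) -> locally t (fun z => D (x, z)).
Proof.
intros oD Dxt.
apply (locally_2d_1d_const_x (fun a b => D (a, b)) x t).
apply locally_2d_locally.
apply (filter_imp D); [intros [a b]; exact (fun h => h) | exact (oD _ Dxt)].
Qed.

Lemma smooth_is_derive_x D f x t :
  smooth_on D f -> D (x, t) -> is_derive (fun z => f z t) x (dx f x t).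
Proof.
intros sf Dxt; apply Derive_correct.
destruct (sf 1%nat x t Dxt) as [_ [H _]]; exact H.
Qed.

Lemma smooth_is_derive_t D f x t :
  smooth_on D f -> D (x, t) -> is_derive (fun z => f x z) t (dt f x t).
Proof.
intros sf Dxt; apply Derive_correct.
destruct (sf 1%nat x t Dxt) as [_ [_ [H _]]]; exact H.
Qed.

Lemma smooth_on_dx D f : smooth_on D f -> smooth_on D (dx f).
Proof.
intros sf k x t Dxt; exact (ex_diff_n_deriv_aux1 f k x t (sf (S k) x t Dxt)).
Qed.

(** Differentiability in both variables jointly is what the chain rule along a
    curve needs; existence of the two partial derivatives would not suffice. *)
Lemma smooth_differentiable D f x t :
  open D -> smooth_on D f -> D (x, t) ->
  differentiable_pt_lim f x t (dx f x t) (dt f x t).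
Proof.
intros oD sf Dxt.
apply filterdiff_differentiable_pt_lim.
apply (is_derive_filterdiff f x t (dx f) (dt f x t)).
- apply (filter_imp D); [|exact (oD _ Dxt)].
  intros [a b] Dab; exact (smooth_is_derive_x D f a b sf Dab).
- exact (smooth_is_derive_t D f x t sf Dxt).
- apply continuity_2d_pt_filterlim.
  destruct (smooth_on_dx D f sf 0%nat x t Dxt) as [H _]; exact H.
Qed.

(** * Exchanging the dependent and an independent variable *)

(** The inverse of the hodograph map preserves the time, so it is given by one
    function [X], characterized by [X (v x t) t = x]. Differentiating this
    identity in [x] and in [t] gives the partial derivatives of [X], and shows
    that [v] has a nonzero [x]-derivative. *)
Lemma hodograph_inverse (D D' : R * R -> Prop) (v : R -> R -> R) :
  smooth_on D v -> is_diffeo D D' v (fun _ t => t) ->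
  exists X : R -> R -> R,
    (forall y s, D' (y, s) -> D (X y s, s) /\ v (X y s) s = y) /\
    (forall x t, D (x, t) ->
       X (v x t) t = x /\ dx v x t <> 0 /\
       is_derive (fun y => X y t) (v x t) (/ dx v x t) /\
       is_derive (fun s => X (v x t) s) t (- (dt v x t / dx v x t))).
Proof.
intros sv [oD [oD' [_ [_ [vD [X [T [sX [_ [XD [XK vK]]]]]]]]]]].
exists X; split.
{ intros y s D'ys.
  destruct (vK y s D'ys) as [Hv HT].
  rewrite HT in Hv; split; [|exact Hv].
  rewrite <- HT at 2; exact (XD y s D'ys). }
intros x t Dxt.
pose proof (vD x t Dxt) as D'vt.
pose proof (smooth_is_derive_x D' X _ _ sX D'vt) as HXy.
pose proof (smooth_is_derive_t D' X _ _ sX D'vt) as HXs.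
pose proof (smooth_is_derive_x D v _ _ sv Dxt) as Hvx.
pose proof (smooth_is_derive_t D v _ _ sv Dxt) as Hvt.
(* The two derivatives of the identity [X (v x t) t = x]. *)
assert (Ex : dx v x t * dx X (v x t) t = 1).
{ transitivity (Derive (fun z => X (v z t) t) x).
  - symmetry; apply is_derive_unique.
    exact (is_derive_comp (fun y => X y t) (fun z => v z t) x _ _ HXy Hvx).
  - apply is_derive_unique, (is_derive_ext_loc (fun z => z)).
    + apply (filter_imp (fun z => D (z, t))); [|exact (open_locally_x D x t oD Dxt)].
      intros z Dzt; symmetry; exact (proj1 (XK z t Dzt)).
    + exact (is_derive_id x). }
assert (Et : dx X (v x t) t * dt v x t + dt X (v x t) t * 1 = 0).
{ transitivity (Derive (fun s => X (v x s) s) t).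
  - symmetry; apply is_derive_unique, is_derive_Reals.
    apply (derivable_pt_lim_comp_2d X (fun s => v x s) (fun s => s)).
    + exact (smooth_differentiable D' X _ _ oD' sX D'vt).
    + apply is_derive_Reals; exact Hvt.
    + apply derivable_pt_lim_id.
  - apply is_derive_unique, (is_derive_ext_loc (fun _ => x)).
    + apply (filter_imp (fun s => D (x, s))); [|exact (open_locally_t D x t oD Dxt)].
      intros s Dxs; symmetry; exact (proj1 (XK x s Dxs)).
    + exact (is_derive_const x t). }
assert (v0 : dx v x t <> 0) by (intro E; rewrite E in Ex; lra).
assert (EXy : dx X (v x t) t = / dx v x t).
{ apply (Rmult_eq_reg_l (dx v x t)); [rewrite Ex; field|]; assumption. }
split; [exact (proj1 (XK x t Dxt))|split; [exact v0|split]].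
- rewrite <- EXy; exact HXy.
- replace (- (dt v x t / dx v x t)) with (dt X (v x t) t); [exact HXs|].
  rewrite EXy in Et; unfold Rdiv; lra.
Qed.

(** In the new variables an [x']-derivative is an [x]-derivative divided by
    [dx v]. *)
Lemma hodograph_dx (D D' : R * R -> Prop) (v f g : R -> R -> R) x t l :
  smooth_on D v -> is_diffeo D D' v (fun _ t => t) ->
  (forall x t, D (x, t) -> f (v x t) t = g x t) ->
  D (x, t) -> is_derive (fun z => g z t) x l ->
  dx f (v x t) t = l / dx v x t.
Proof.
intros sv dv fg Dxt Hg.
destruct (hodograph_inverse D D' v sv dv) as [X [XD XK]].
destruct (XK x t Dxt) as [EX [_ [HX _]]].
destruct dv as [_ [oD' [_ [_ [vD _]]]]].
transitivity (/ dx v x t * l); [|apply Rmult_comm].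
apply is_derive_unique, (is_derive_ext_loc (fun y => g (X y t) t)).
- apply (filter_imp (fun y => D' (y, t))).
  + intros y D'yt; destruct (XD y t D'yt) as [DX vX].
    rewrite <- (fg _ _ DX), vX; reflexivity.
  + exact (open_locally_x D' _ _ oD' (vD x t Dxt)).
- apply (is_derive_comp (fun z => g z t) (fun y => X y t)); [|exact HX].
  rewrite EX; exact Hg.
Qed.

(** A function of the old position alone depends on the new time only through
    the motion of the level sets of [v], whose speed is [- dt v / dx v]. *)
Lemma hodograph_dt (D D' : R * R -> Prop) (v f : R -> R -> R) (S : R -> R) x t l :
  smooth_on D v -> is_diffeo D D' v (fun _ t => t) ->
  (forall x t, D (x, t) -> f (v x t) t = S x) ->
  D (x, t) -> is_derive S x l ->
  dt f (v x t) t = - (l * dt v x t / dx v x t).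
Proof.
intros sv dv fS Dxt HS.
destruct (hodograph_inverse D D' v sv dv) as [X [XD XK]].
destruct (XK x t Dxt) as [EX [_ [_ HX]]].
destruct dv as [_ [oD' [_ [_ [vD _]]]]].
transitivity (- (dt v x t / dx v x t) * l); [|unfold Rdiv; ring].
apply is_derive_unique, (is_derive_ext_loc (fun s => S (X (v x t) s))).
- apply (filter_imp (fun s => D' (v x t, s))).
  + intros s D's; destruct (XD _ _ D's) as [DX vX].
    rewrite <- (fS _ _ DX), vX; reflexivity.
  + exact (open_locally_t D' _ _ oD' (vD x t Dxt)).
- apply (is_derive_comp S (fun s => X (v x t) s)); [|exact HX].
  rewrite EX; exact HS.
Qed.

Lemma hodograph_dx_neq0 (D D' : R * R -> Prop) (v : R -> R -> R) x t :
  smooth_on D v -> is_diffeo D D' v (fun _ t => t) -> D (x, t) -> dx v x t <> 0.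
Proof.
intros sv dv Dxt.
destruct (hodograph_inverse D D' v sv dv) as [X [_ XK]].
exact (proj1 (proj2 (XK x t Dxt))).
Qed.

Lemma hodograph_forall_iff (D D' : R * R -> Prop) (v : R -> R -> R)
    (E' E : R -> R -> Prop) :
  smooth_on D v -> is_diffeo D D' v (fun _ t => t) ->
  (forall x t, D (x, t) -> E' (v x t) t <-> E x t) ->
  (forall y s, D' (y, s) -> E' y s) <-> (forall x t, D (x, t) -> E x t).
Proof.
intros sv dv E'E.
destruct (hodograph_inverse D D' v sv dv) as [X [XD _]].
destruct dv as [_ [_ [_ [_ [vD _]]]]].
split; intros H.
- intros x t Dxt; apply (E'E x t Dxt), H, (vD x t Dxt).
- intros y s D'ys; destruct (XD y s D'ys) as [DX vX].
  rewrite <- vX; apply (E'E _ _ DX), H, DX.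
Qed.

(** * The equations at a point *)

Lemma Rpower_neq0 x a : Rpower x a <> 0.
Proof. apply Rgt_not_eq, exp_pos. Qed.

Lemma is_derive_Rpower a x :
  0 < x -> is_derive (fun z => Rpower z a) x (a * Rpower x (a - 1)).
Proof. intros x0; apply is_derive_Reals, derivable_pt_lim_power, x0. Qed.

Lemma is_derive_new_v n x :
  n <> -2 -> n <> -1 -> 0 < x ->
  is_derive
    (fun z => (n + 2) / (2 * (n + 1)) * Rpower z (2 * (n + 1) / (n + 2))) x
    (Rpower x (n / (n + 2))).
Proof.
intros hn2 hn1 x0.
replace (Rpower x (n / (n + 2)))
  with ((n + 2) / (2 * (n + 1)) *
        (2 * (n + 1) / (n + 2) * Rpower x (2 * (n + 1) / (n + 2) - 1))).
- apply is_derive_scal, is_derive_Rpower, x0.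
- replace (2 * (n + 1) / (n + 2) - 1) with (n / (n + 2)) by (field; lra).
  field; lra.
Qed.

Lemma is_derive_new_u n (u : R -> R) x l :
  0 < x -> u x <> 0 -> is_derive u x l ->
  is_derive (fun z => Rpower z (- (2 / (n + 2))) * / u z) x
    (- Rpower x (- (2 / (n + 2)))
       * (2 / (n + 2) / (x * u x) + l / (u x) ^ 2)).
Proof.
intros x0 u0 Hu.
replace (- Rpower x _ * _)
  with (- (2 / (n + 2)) * Rpower x (- (2 / (n + 2)) - 1) * / u x +
        Rpower x (- (2 / (n + 2))) * (- l / (u x) ^ 2)).
- apply (is_derive_mult (fun z => Rpower z (- (2 / (n + 2)))) (fun z => / u z)).
  + apply is_derive_Rpower, x0.
  + apply is_derive_inv; assumption.
  + exact Rmult_comm.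
- unfold Rminus; rewrite Rpower_plus, (Rpower_Ropp x 1), (Rpower_1 x x0).
  set (c := 2 / (n + 2)).
  field; split; [|lra]; assumption.
Qed.

Lemma Rpower_quotient n x :
  n <> -2 -> 0 < x -> Rpower x (n / (n + 2)) = x * Rpower x (- (2 / (n + 2))).
Proof.
intros hn2 x0.
rewrite <- (Rpower_1 x x0) at 2; rewrite <- Rpower_plus.
f_equal; field; lra.
Qed.

(** The exponent of [x] in [u'] is chosen so that the power [- (n + 2)] of
    [u'] is [x ^ 2 * u ^ (n + 2)]. *)
Lemma Rpower_new_u n x u :
  n <> -2 -> 0 < x -> 0 < u ->
  Rpower (Rpower x (- (2 / (n + 2))) * / u) (- (n + 2)) =
  x ^ 2 * (u ^ 2 * Rpower u n).
Proof.
intros hn2 x0 u0.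
rewrite <- Rpower_mult_distr; [|apply exp_pos|apply Rinv_0_lt_compat, u0].
rewrite Rpower_mult, <- (Rpower_pow 2 x x0), <- (Rpower_pow 2 u u0).
rewrite <- Rpower_plus.
f_equal.
- f_equal; simpl; field; lra.
- rewrite <- (Rpower_1 u u0) at 1; rewrite <- Rpower_Ropp, Rpower_mult.
  f_equal; simpl; ring.
Qed.

(** The two sides of the first equation are [v'_x'] and [u']; the powers of
    [x] differ by exactly one factor [x]. *)
Lemma new_vx_iff n x u vx :
  n <> -2 -> 0 < x -> u <> 0 -> vx <> 0 ->
  Rpower x (n / (n + 2)) / vx = Rpower x (- (2 / (n + 2))) * / u <-> vx = u * x.
Proof.
intros hn2 x0 u0 vx0.
rewrite (Rpower_quotient n x hn2 x0).
pose proof (Rpower_neq0 x (- (2 / (n + 2)))) as p0.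
set (p := Rpower x _) in *.
split; intros H.
- apply (Rmult_eq_reg_l (p / (vx * u))).
  + transitivity (p * / u); [field; tauto|rewrite <- H; field; tauto].
  + apply Rmult_integral_contrapositive_currified;
      [exact p0|apply Rinv_neq_0_compat].
    apply Rmult_integral_contrapositive_currified; assumption.
- rewrite H; field; split; lra.
Qed.

(** Both sides of the evolution equation for [v'] are those of the equation for
    [v], multiplied by the same nonzero factor
    [- x ^ (n / (n + 2)) / dx v]. *)
Lemma new_evolution_iff n x u ux vx vt :
  n <> -2 -> 0 < x -> 0 < u -> vx <> 0 ->
  - (Rpower x (n / (n + 2)) * vt / vx) =
    Rpower (Rpower x (- (2 / (n + 2))) * / u) (- (n + 2)) *
    (- Rpower x (- (2 / (n + 2))) * (2 / (n + 2) / (x * u) + ux / u ^ 2) / vx)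
  <-> vt = x * Rpower u n * ux + 2 / (n + 2) * Rpower u (n + 1).
Proof.
intros hn2 x0 u0 vx0.
rewrite (Rpower_new_u n x u hn2 x0 u0), (Rpower_quotient n x hn2 x0).
rewrite Rpower_plus, (Rpower_1 u u0).
pose proof (Rpower_neq0 x (- (2 / (n + 2)))) as p0.
set (p := Rpower x _) in *; set (q := Rpower u n); set (c := 2 / (n + 2)).
assert (k0 : - (x * p / vx) <> 0).
{ apply Ropp_neq_0_compat, Rmult_integral_contrapositive_currified;
    [|apply Rinv_neq_0_compat, vx0].
  apply Rmult_integral_contrapositive_currified; [lra|exact p0]. }
replace (- (x * p * vt / vx)) with (- (x * p / vx) * vt) by (field; exact vx0).
replace (x ^ 2 * (u ^ 2 * q) * (- p * (c / (x * u) + ux / u ^ 2) / vx))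
  with (- (x * p / vx) * (x * q * ux + c * (q * u)))
  by (field; repeat split; lra).
split; intros H; [exact (Rmult_eq_reg_l _ _ _ H k0)|rewrite H; reflexivity].
Qed.

Theorem mainTheorem15 (n mu : R) (hn2 : n <> -2) (hn1 : n <> -1)
    (hmu : mu = (3 * n + 4) / (n + 2)) :
  maps_system
    (fun x t v => v)
    (fun x t u v => Rpower x (- (2 / (n + 2))) * / u)
    (fun x t v => (n + 2) / (2 * (n + 1)) * Rpower x (2 * (n + 1) / (n + 2)))
    (fun u' v' x' t' =>
       dx v' x' t' = u' x' t' /\
       dt v' x' t' = Rpower (u' x' t') (- (n + 2)) * dx u' x' t')
    (fun u v x t =>
       dx v x t = u x t * x /\
       dt v x t = x * Rpower (u x t) n * dx u x t
                  + (mu - 1) / (n + 1) * Rpower (u x t) (n + 1))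
  /\
  maps_equation
    (fun x t v => v)
    (fun x t v => (n + 2) / (2 * n + 2) * Rpower x ((2 * n + 2) / (n + 2)))
    (fun v' x' t' =>
       dt v' x' t' = Rpower (dx v' x' t') (- (n + 2)) * dxx v' x' t')
    (fun v x t =>
       dt v x t = Rpower (dx v x t / x) n * dxx v x t
                  - n / (n + 2) * Rpower (dx v x t / x) (n + 1)).
Proof.
split.
- intros D D' u v u' v' oD xD su sv uD dv Eu' Ev'.
  change (is_diffeo D D' v (fun _ t => t)) in dv.
  apply (hodograph_forall_iff D D' v _ _ sv dv); intros x t Dxt.
  pose proof (xD x t Dxt) as x0; pose proof (uD x t Dxt) as u0.
  pose proof (hodograph_dx_neq0 D D' v x t sv dv Dxt) as vx0.
  pose proof (is_derive_new_v n x hn2 hn1 x0) as HS.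
  rewrite (hodograph_dx D D' v v' _ x t _ sv dv Ev' Dxt HS).
  rewrite (hodograph_dt D D' v v' _ x t _ sv dv Ev' Dxt HS).
  rewrite (hodograph_dx D D' v u' (fun x t => Rpower x (- (2 / (n + 2))) * / u x t)
             x t _ sv dv Eu' Dxt
             (is_derive_new_u n (fun z => u z t) x _ x0 (Rgt_not_eq _ _ u0)
                (smooth_is_derive_x D u x t su Dxt))).
  rewrite (Eu' x t Dxt).
  replace ((mu - 1) / (n + 1)) with (2 / (n + 2)) by (rewrite hmu; field; lra).
  rewrite (new_vx_iff n x _ _ hn2 x0 (Rgt_not_eq _ _ u0) vx0).
  rewrite (new_evolution_iff n x _ _ _ _ hn2 x0 u0 vx0).
  reflexivity.
- (* The scalar case is reduced to the system by introducing [u = v_x / x]. *)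
  intros D D' v v' oD xD sv vxD dv Ev'.
  change (is_diffeo D D' v (fun _ t => t)) in dv.
  replace (2 * n + 2) with (2 * (n + 1)) in Ev' by ring.
  set (u := fun x t => dx v x t / x).
  assert (uD : forall x t, D (x, t) -> 0 < u x t).
  { intros x t Dxt; apply Rdiv_lt_0_compat; [exact (vxD x t Dxt)|exact (xD x t Dxt)]. }
  assert (Evx' : forall x t, D (x, t) ->
            dx v' (v x t) t = Rpower x (- (2 / (n + 2))) * / u x t).
  { intros x t Dxt; pose proof (xD x t Dxt) as x0.
    rewrite (hodograph_dx D D' v v' _ x t _ sv dv Ev' Dxt
               (is_derive_new_v n x hn2 hn1 x0)).
    apply (new_vx_iff n x); try assumption.
    - exact (Rgt_not_eq _ _ (uD x t Dxt)).
    - exact (Rgt_not_eq _ _ (vxD x t Dxt)).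
    - unfold u; field; lra. }
  apply (hodograph_forall_iff D D' v _ _ sv dv); intros x t Dxt.
  pose proof (xD x t Dxt) as x0; pose proof (uD x t Dxt) as u0.
  assert (Hu : is_derive (fun z => u z t) x (dxx v x t / x - dx v x t / x ^ 2)).
  { replace (dxx v x t / x - dx v x t / x ^ 2)
      with ((dxx v x t * x - dx v x t * 1) / x ^ 2) by (field; lra).
    apply (is_derive_div (fun z => dx v z t) (fun z => z)); [| |lra].
    - exact (smooth_is_derive_x D (dx v) x t (smooth_on_dx D v sv) Dxt).
    - exact (is_derive_id x). }
  rewrite (hodograph_dt D D' v v' _ x t _ sv dv Ev' Dxt
             (is_derive_new_v n x hn2 hn1 x0)).
  change (dxx v' (v x t) t) with (dx (dx v') (v x t) t).
  rewrite (hodograph_dx D D' v (dx v')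
             (fun x t => Rpower x (- (2 / (n + 2))) * / u x t) x t _ sv dv Evx' Dxt
             (is_derive_new_u n (fun z => u z t) x _ x0 (Rgt_not_eq _ _ u0) Hu)).
  rewrite (Evx' x t Dxt).
  rewrite (new_evolution_iff n x _ _ _ _ hn2 x0 u0 (Rgt_not_eq _ _ (vxD x t Dxt))).
  fold (u x t).
  replace (x * Rpower (u x t) n * (dxx v x t / x - dx v x t / x ^ 2)
             + 2 / (n + 2) * Rpower (u x t) (n + 1))
    with (Rpower (u x t) n * dxx v x t - n / (n + 2) * Rpower (u x t) (n + 1)).
  + reflexivity.
  + rewrite Rpower_plus, (Rpower_1 _ u0).
    set (q := Rpower (u x t) n); unfold u; field; split; lra.
Qed.
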